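(* Let $V:\mathbb{R}\to[0,\infty)$ be an optimal velocity function, let $h^\star<h<\infty$ and $d\in\mathbb{R}$, and let $w^{c_2(h),d}$ be the wavefront solution with constant-speed, belonging to the second branch $c_2$, of the delay differential equation $w'(t)=f(w_t)$ with parameter $h$. Then $w^{c_2(h),d}$ is unstable.
   Context: Optimal velocity function: $V:\mathbb{R}\to[0,\infty)$ such that (OVF 1) $V$ is non-negative and monotonically increasing (in the weak sense); (OVF 2) $V$ is bounded from above by some $V^{\max}>0$ and $\lim_{s\to\infty}V(s)=V^{\max}$; (OVF 3) there is $d_S\ge0$ such that $V(s)=0$ for all $s\le d_S$ and $V(s)>0$ for all $s>d_S$; (OVF 4) $V$ is $C^1$-smooth, twice continuously differentiable in $(d_S,\infty)$, and there is $b>0$ such that $V'$ is strictly increasing in $(d_S,b)$ and strictly decreasing in $(b,\infty)$. The equation: $C$ is the Banach space of continuous functions $\varphi=(\varphi_1,\varphi_2):[-1,0]\to\mathbb{R}^2$ with norm $\|\varphi\|_C=\sup_{-1\le s\le0}\|\varphi(s)\|_{\mathbb{R}^2}$ (Euclidean norm on $\mathbb{R}^2$). For a continuous $\mathbb{R}^2$-valued function $w$ defined on an interval containing $[t-1,t]$, the segment $w_t\in C$ is $w_t(s)=w(t+s)$, $-1\le s\le0$. For a parameter $h>0$, $f:C\to\mathbb{R}^2$ is $$f(\varphi)=\begin{pmatrix}\varphi_2(0)\\ h^2V(\varphi_1(-1)-\varphi_1(0))+h\,\varphi_2(0)\end{pmatrix}.$$ For each $\varphi\in C$ there is a unique solution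 $w^\varphi:[-1,\infty)\to\mathbb{R}^2$ of $w'(t)=f(w_t)$ with $w^\varphi_0=\varphi$ (continuous on $[-1,\infty)$, continuously differentiable and satisfying the equation for $t>0$). Wavefront solutions: for $c>0$ with $hV(c)=c$ and $d\in\mathbb{R}$, the function $w^{c,d}(t)=(-ct+d,-c)^T$, $t\in\mathbb{R}$, is a solution of $w'(t)=f(w_t)$, called a wavefront solution with constant-speed. Second branch: there is a unique pair $(c^\star,h^\star)$ of positive reals with $h^\star V(c^\star)=c^\star$ and $h^\star V'(c^\star)=1$. For each $h>h^\star$, $c_2(h)$ denotes the unique $c\in(c^\star,\infty)$ with $hV(c)=c$; it is known that $c_2:(h^\star,\infty)\to(c^\star,\infty)$ is well defined and continuously differentiable. Stability: $w^{c,d}$ is stable if for every $\varepsilon>0$ there is $\delta>0$ such that $\|w_0^{c,d}-\varphi\|_C<\delta$, $\varphi\in C$, implies $\|w_t^{c,d}-w_t^\varphi\|_C<\varepsilon$ for all $t\ge0$; otherwise it is unstable. *)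

(* Defs.v *)
From Stdlib Require Import Reals.
From Coquelicot Require Import Coquelicot.
Open Scope R_scope.

Record optimal_velocity (V : R -> R) : Prop := {
  ovf_nonneg : forall s, 0 <= V s;
  ovf_monotone : forall s t, s <= t -> V s <= V t;
  ovf_bounded : exists Vmax, 0 < Vmax /\ (forall s, V s <= Vmax)
    /\ is_lim V p_infty Vmax;
  ovf_smooth : exists dS, 0 <= dS
    /\ (forall s, s <= dS -> V s = 0)
    /\ (forall s, dS < s -> 0 < V s)
    /\ (forall s, ex_derive V s /\ continuous (Derive V) s)
    /\ (forall s, dS < s ->
          ex_derive (Derive V) s /\ continuous (Derive (Derive V)) s)
    /\ exists b, 0 < b
       /\ (forall s t, dS < s -> s < t -> t < b -> Derive V s < Derive V t)
       /\ (forall s t, b < s -> s < t -> Derive V t < Derive V s)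
}.

(* Coquelicot's norm on a product is the square root of the sum of the squares
   of the norms, so [norm] is the Euclidean norm on [R2]. *)
Definition R2 := prod_NormedModule R_AbsRing R_NormedModule R_NormedModule.

(* Elements of C are represented by total functions, of which only the values
   on [-1, 0] matter. *)
Definition inC (phi : R -> R2) : Prop :=
  continuous_on (fun s => -1 <= s <= 0) phi.

(* [real] sends an infinite supremum to 0; the supremum is finite as soon as
   [inC phi] holds. *)
Definition normC (phi : R -> R2) : R :=
  real (Lub_Rbar (fun x => exists s, -1 <= s <= 0 /\ x = norm (phi s))).

Definition segment (w : R -> R2) (t : R) : R -> R2 := fun s => w (t + s).

Definition distC (phi psi : R -> R2) : R :=
  normC (fun s => minus (phi s) (psi s)).

Definition rhs (V : R -> R) (h : R) (phi : R -> R2) : R2 :=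
  (snd (phi 0),
   h ^ 2 * V (fst (phi (-1)) - fst (phi 0)) + h * snd (phi 0)).

(* [w] is the solution on [-1, +oo) with initial segment [phi]; its values
   below -1 are irrelevant. *)
Definition is_solution (V : R -> R) (h : R) (phi w : R -> R2) : Prop :=
  (forall s, -1 <= s <= 0 -> segment w 0 s = phi s)
  /\ continuous_on (fun t => -1 <= t) w
  /\ exists dw : R -> R2, forall t, 0 < t ->
       is_derive w t (dw t) /\ continuous dw t /\ dw t = rhs V h (segment w t).

Definition wavefront (c d : R) : R -> R2 := fun t => (- c * t + d, - c).

(* Since the solution with initial segment [phi] exists and is unique,
   quantifying universally over [w] amounts to taking that solution. *)
Definition stable (V : R -> R) (h c d : R) : Prop :=
  forall eps, 0 < eps -> exists delta, 0 < delta /\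
    forall phi w, inC phi -> is_solution V h phi w ->
      distC (segment (wavefront c d) 0) phi < delta ->
      forall t, 0 <= t ->
        distC (segment (wavefront c d) t) (segment w t) < eps.

Definition unstable (V : R -> R) (h c d : R) : Prop := ~ stable V h c d.

(* The pair [(cstar, hstar)] at which the second branch starts; it is
   determined by [V]. *)
Definition critical_pair (V : R -> R) (cstar hstar : R) : Prop :=
  0 < cstar /\ 0 < hstar
  /\ hstar * V cstar = cstar /\ hstar * Derive V cstar = 1.

(* [c] is the value at [h] of the second branch; for [h > hstar] there is
   exactly one such [c]. *)
Definition second_branch (V : R -> R) (cstar h c : R) : Prop :=
  cstar < c /\ h * V c = c.

(* Main.v *)
Require Import Defs.
From Stdlib Require Import Reals Lra.
From Coquelicot Require Import Coquelicot.
Open Scope R_scope.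

(** Write a solution as the wavefront plus a perturbation [(z, p)].  When
    [z' = p] also holds on the initial interval, the delayed difference
    [z (t - 1) - z t] is minus the integral of [p] over [[t - 1, t]], and since
    [h * V c = c] the system becomes one scalar equation with memory,

      [p' t = h * p t - h ^ 2 * (V c - V (c - RInt p (t - 1) t))].

    Two facts about it make the wavefront unstable.

    The second branch lies where [V] is concave, beyond the point where the
    line of slope [/ hstar] through the origin touches the graph, and this
    gives [h * Derive V c < 1] ([second_branch_slope]).  Hence there is [L] with
    [h * L < 1] and [V c - V (c - x) <= L * x] for small [x > 0].  The instant
    [t] is called a record if [p t] is the largest value taken so far.  At a
    record the integral is at most [p t], so by monotonicity of [V]

      [p' t >= h * p t - h ^ 2 * L * p t = h * (1 - h * L) * p t > 0].

    Starting from a constant [x0 > 0], a maximum of [p] over [[0, t]] is a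
    record, where [p] would still be increasing; so it can only be at [t].
    Therefore every instant is a record, [p] grows at least linearly, and it
    leaves the range where the bound by [L] holds, however small [x0] is
    ([perturbation_unbounded]).

    To contradict stability, this argument needs a solution with such an initial
    segment.  [V] is globally Lipschitz ([ovf_lipschitz]), which makes the right-hand side of the scalar equation
    Lipschitz with respect to the maximum over the past, and Picard iteration
    converges on the whole half-line in a norm with an exponential weight
    ([history_picard_fixpoint]). *)

(** * Calculus on the real line *)

Lemma mean_value (f : R -> R) (a b : R) :
  (forall x, ex_derive f x) -> a < b ->
  exists xi, a < xi < b /\ f b - f a = Derive f xi * (b - a).
Proof.
  intros Hf Hab.
  destruct (MVT_cor2 f (Derive f) a b Hab) as [xi [Heq Hxi]].
  - intros x _. apply is_derive_Reals, Derive_correct, Hf.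
  - now exists xi.
Qed.

Lemma derivative_secant_bound (V : R -> R) (c L : R) :
  ex_derive V c -> Derive V c < L ->
  exists rho, 0 < rho /\ forall x, 0 < x < rho -> V c - V (c - x) <= L * x.
Proof.
  intros HV HL.
  apply Derive_correct, is_derive_Reals in HV.
  destruct (HV (L - Derive V c) ltac:(lra)) as [rho Hrho].
  exists rho. split; [apply cond_pos |]. intros x Hx.
  specialize (Hrho (- x) ltac:(lra)).
  rewrite Rabs_Ropp, Rabs_pos_eq in Hrho by lra.
  specialize (Hrho (proj2 Hx)). apply Rabs_def2 in Hrho.
  assert (Hq : (V (c + - x) - V c) / - x < L) by lra.
  apply (Rmult_lt_compat_r x) in Hq; [| lra].
  replace ((V (c + - x) - V c) / - x * x) with (V c - V (c + - x)) in Hq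
    by (field; lra).
  unfold Rminus at 2. lra.
Qed.

Lemma continuous_ex_RInt (f : R -> R) (a b : R) :
  (forall s, continuous f s) -> ex_RInt f a b.
Proof. intros Hf. apply (ex_RInt_continuous f). intros; apply Hf. Qed.

Lemma is_derive_primitive (f : R -> R) (a : R) :
  (forall s, continuous f s) ->
  forall t, is_derive (fun u => RInt f a u) t (f t).
Proof.
  intros Hf t. apply (is_derive_RInt f _ a); [| apply Hf].
  apply filter_forall. intros u.
  now apply (RInt_correct f), continuous_ex_RInt.
Qed.

Lemma continuous_primitive (f : R -> R) (a : R) :
  (forall s, continuous f s) ->
  forall t, continuous (fun u => RInt f a u) t.
Proof.
  intros Hf t. apply (ex_derive_continuous (fun u => RInt f a u)).
  eexists. now apply is_derive_primitive.
Qed.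

Lemma geometric_small (x C : R) :
  (forall n, x <= C * (1 / 2) ^ n) -> x <= 0.
Proof.
  intros H.
  apply (is_lim_seq_le (fun _ => x) (fun n => C * (1 / 2) ^ n) x 0 H).
  - apply is_lim_seq_const.
  - replace (Finite 0) with (Rbar_mult C 0) by (simpl; f_equal; ring).
    apply is_lim_seq_scal_l, is_lim_seq_geom.
    rewrite Rabs_pos_eq; lra.
Qed.

(** The explicit rate carries uniformity: when [u] depends on a parameter, so
    does only [a], and the convergence is locally uniform as soon as [a] is
    locally bounded. *)
Lemma geometric_limit (u : nat -> R) (a : R) :
  (forall n, Rabs (u (S n) - u n) <= a * (1 / 2) ^ n) ->
  forall n, Rabs (real (Lim_seq u) - u n) <= 2 * a * (1 / 2) ^ n.
Proof.
  intros Hstep.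
  assert (Htail : forall k n, Rabs (u (n + k)%nat - u n) <= 2 * a * (1 / 2) ^ n).
  { induction k as [| k IH]; intros n.
    - rewrite Nat.add_0_r, Rminus_diag, Rabs_R0.
      pose proof (Rle_trans _ _ _ (Rabs_pos _) (Hstep n)). lra.
    - replace (n + S k)%nat with (S n + k)%nat by (rewrite Nat.add_succ_r; reflexivity).
      replace (u (S n + k)%nat - u n)
        with ((u (S n + k)%nat - u (S n)) + (u (S n) - u n)) by ring.
      eapply Rle_trans; [apply Rabs_triang |].
      specialize (IH (S n)). specialize (Hstep n). simpl pow in IH. lra. }
  assert (Hcv : ex_finite_lim_seq u).
  { apply ex_lim_seq_cauchy_corr. intros eps.
    assert (Ha : 0 <= a).
    { pose proof (Rle_trans _ _ _ (Rabs_pos _) (Hstep 0%nat)) as H0.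
      simpl in H0. lra. }
    destruct (pow_lt_1_zero (1 / 2) ltac:(rewrite Rabs_pos_eq; lra)
                (eps / (4 * a + 1))) as [N HN].
    { apply Rdiv_lt_0_compat; [apply cond_pos | lra]. }
    exists N. intros n m Hn Hm.
    specialize (HN N (le_n _)).
    rewrite Rabs_pos_eq in HN by (apply pow_le; lra).
    assert (HN' : (4 * a + 1) * (1 / 2) ^ N < eps).
    { apply (Rmult_lt_compat_l (4 * a + 1)) in HN; [| lra].
      replace ((4 * a + 1) * (eps / (4 * a + 1))) with (pos eps) in HN
        by (field; lra).
      exact HN. }
    pose proof (pow_lt (1 / 2) N ltac:(lra)).
    pose proof (Htail (n - N)%nat N) as H1.
    pose proof (Htail (m - N)%nat N) as H2.
    rewrite <- (Nat.add_comm (n - N)), Nat.sub_add in H1 by assumption.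
    rewrite <- (Nat.add_comm (m - N)), Nat.sub_add in H2 by assumption.
    rewrite Rabs_minus_sym in H2.
    replace (u n - u m) with ((u n - u N) + (u N - u m)) by ring.
    eapply Rle_lt_trans; [apply Rabs_triang |]. lra. }
  destruct Hcv as [l Hl].
  rewrite (is_lim_seq_unique _ _ Hl). simpl. intros n.
  apply (is_lim_seq_le (fun k => Rabs (u (k + n)%nat - u n))
           (fun _ => 2 * a * (1 / 2) ^ n) (Rabs (l - u n)) (2 * a * (1 / 2) ^ n)).
  - intros k. rewrite Nat.add_comm. apply Htail.
  - apply (is_lim_seq_abs _ (l - u n)).
    apply is_lim_seq_minus'; [| apply is_lim_seq_const].
    now apply (is_lim_seq_incr_n u n).
  - apply is_lim_seq_const.
Qed.

Lemma continuous_geometric_limit (f : R -> R) (g : nat -> R -> R) (x : R) (U : R -> Prop) (C : R) :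
  locally x U ->
  (forall n, continuous (g n) x) ->
  (forall n y, U y -> Rabs (f y - g n y) <= C * (1 / 2) ^ n) ->
  continuous f x.
Proof.
  intros HU Hg Hfg. apply filterlim_locally. intros eps.
  destruct (is_lim_seq_geom (1 / 2) ltac:(rewrite Rabs_pos_eq; lra)
              (fun y => Rabs C * y < eps / 3)) as [n Hn].
  { assert (HC : 0 < Rabs C + 1) by (pose proof (Rabs_pos C); lra).
    pose proof (cond_pos eps).
    exists (mkposreal (eps / 3 / (Rabs C + 1))
              ltac:(apply Rdiv_lt_0_compat; lra)).
    intros y Hy. apply Rabs_def2 in Hy.
    unfold minus, plus, opp in Hy. simpl in Hy.
    apply Rle_lt_trans with (Rabs C * (eps / 3 / (Rabs C + 1))).
    - apply Rmult_le_compat_l; [apply Rabs_pos | lra].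
    - replace (eps / 3) with ((Rabs C + 1) * (eps / 3 / (Rabs C + 1))) at 2
        by (field; lra).
      apply Rmult_lt_compat_r; [apply Rdiv_lt_0_compat |]; lra. }
  specialize (Hn n (le_n _)).
  assert (Hlt : C * (1 / 2) ^ n < eps / 3).
  { eapply Rle_lt_trans; [| apply Hn].
    apply Rmult_le_compat_r; [apply pow_le; lra | apply Rle_abs]. }
  pose proof (cond_pos eps).
  pose proof (proj1 (filterlim_locally _ _) (Hg n)
                (mkposreal (eps / 3) ltac:(lra))) as Hgn.
  generalize (filter_and _ _ HU Hgn). apply filter_imp.
  intros y [HUy Hgy].
  pose proof (Hfg n y HUy) as H1.
  pose proof (Hfg n x (locally_singleton _ _ HU)) as H2.
  change (Rabs (g n y - g n x) < eps / 3) in Hgy.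
  change (Rabs (f y - f x) < eps).
  replace (f y - f x)
    with ((f y - g n y) + (g n y - g n x) + (g n x - f x)) by ring.
  rewrite Rabs_minus_sym in H2.
  eapply Rle_lt_trans; [apply Rabs_triang |].
  pose proof (Rabs_triang (f y - g n y) (g n y - g n x)). lra.
Qed.

(** * Optimal velocity functions and the second branch *)

Lemma ovf_ex_derive (V : R -> R) :
  optimal_velocity V -> forall s, ex_derive V s.
Proof.
  intros [_ _ _ (dS & _ & _ & _ & Hc1 & _)] s. apply Hc1.
Qed.

(** [Derive V] vanishes to the left of [0], is bounded on [[0, b + 1]] by
    compactness, and decreases afterwards. *)
Lemma ovf_lipschitz (V : R -> R) :
  optimal_velocity V ->
  exists L, 0 < L /\ forall s t, Rabs (V s - V t) <= L * Rabs (s - t).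
Proof.
  intros hV.
  pose proof (ovf_ex_derive V hV) as Hder.
  destruct hV as [_ Hmon _ (dS & HdS & Hzero & _ & Hc1 & _ & b & Hb & _ & Hdec)].
  destruct (continuity_ab_maj (Derive V) 0 (b + 1)) as [m [Hm Hm01]].
  { lra. }
  { intros x _. apply continuity_pt_filterlim, Hc1. }
  assert (Hbound : forall s, Derive V s <= Rabs (Derive V m) + 1).
  { intros s. pose proof (Rle_abs (Derive V m)).
    destruct (Rlt_le_dec s 0) as [Hs | Hs].
    - assert (Derive V s = 0) as ->.
      { rewrite (Derive_ext_loc V (fun _ => 0)); [apply Derive_const |].
        exists (mkposreal (- s) ltac:(lra)). intros y Hy. apply Hzero.
        apply Rabs_def2 in Hy. unfold minus, plus, opp in Hy. simpl in Hy. lra. }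
      pose proof (Rabs_pos (Derive V m)). lra.
    - destruct (Rle_lt_dec s (b + 1)) as [Hs1 | Hs1].
      + specialize (Hm s ltac:(lra)). lra.
      + specialize (Hm (b + 1) ltac:(lra)).
        specialize (Hdec (b + 1) s ltac:(lra) Hs1). lra. }
  exists (Rabs (Derive V m) + 1). split.
  { pose proof (Rabs_pos (Derive V m)). lra. }
  assert (Hlt : forall s t, s < t ->
            Rabs (V t - V s) <= (Rabs (Derive V m) + 1) * (t - s)).
  { intros s t Hst.
    destruct (mean_value V s t Hder Hst) as [xi [_ Heq]].
    rewrite Rabs_pos_eq by (specialize (Hmon s t ltac:(lra)); lra).
    rewrite Heq. apply Rmult_le_compat_r; [lra | apply Hbound]. }
  intros s t. destruct (Rtotal_order s t) as [Hst | [-> | Hst]].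
  - rewrite Rabs_minus_sym, (Rabs_minus_sym s t), (Rabs_pos_eq (t - s)) by lra.
    now apply Hlt.
  - rewrite !Rminus_diag, Rabs_R0. lra.
  - rewrite (Rabs_pos_eq (s - t)) by lra. now apply Hlt.
Qed.

(** Convexity on [(dS, b)] would give [V cstar < cstar * Derive V cstar], which
    contradicts the definition of the critical pair; so [b <= cstar], and [V]
    is strictly concave beyond [cstar].  For [xi] between [cstar] and [c]
    supplied by the mean value theorem,
    [V c = cstar * Derive V cstar + (c - cstar) * Derive V xi].  Concavity gives
    [Derive V c < Derive V xi], and [hstar < h] puts the point [(c, V c)] below
    the line of slope [/ hstar] through the origin, so that
    [Derive V xi < Derive V cstar].  Hence [c * Derive V c < V c = c / h]. *)
Lemma second_branch_slope (V : R -> R) (cstar hstar h c : R) :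
  optimal_velocity V -> critical_pair V cstar hstar -> hstar < h ->
  second_branch V cstar h c -> h * Derive V c < 1.
Proof.
  intros hV (Hcs & Hhs & Hfix & Hcrit) Hh [Hc Hbr].
  pose proof (ovf_ex_derive V hV) as Hder.
  destruct hV as [_ _ _ (dS & HdS & Hzero & _ & _ & _ & b & Hb & Hinc & Hdec)].
  assert (HVcs : V cstar = cstar * Derive V cstar).
  { apply (Rmult_eq_reg_l hstar); [| lra]. rewrite Hfix.
    replace (hstar * (cstar * Derive V cstar))
      with (cstar * (hstar * Derive V cstar)) by ring.
    rewrite Hcrit. ring. }
  assert (Hslope : 0 < Derive V cstar).
  { apply (Rmult_lt_reg_l hstar); lra. }
  assert (HVpos : 0 < V cstar).
  { rewrite HVcs. now apply Rmult_lt_0_compat. }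
  assert (HdScs : dS < cstar).
  { destruct (Rlt_le_dec dS cstar) as [| Hle]; trivial.
    rewrite (Hzero _ Hle) in HVpos. lra. }
  assert (Hbcs : b <= cstar).
  { destruct (Rle_lt_dec b cstar) as [| Hlt]; trivial. exfalso.
    destruct (mean_value V dS cstar Hder HdScs) as [xi [Hxi Heq]].
    rewrite (Hzero dS (Rle_refl _)) in Heq.
    specialize (Hinc xi cstar (proj1 Hxi) (proj2 Hxi) Hlt).
    assert (Derive V xi * (cstar - dS) < Derive V cstar * (cstar - dS)).
    { apply Rmult_lt_compat_r; lra. }
    assert (0 <= Derive V cstar * dS) by (apply Rmult_le_pos; lra).
    lra. }
  destruct (mean_value V cstar c Hder Hc) as [xi [Hxi Heq]].
  assert (Hh0 : 0 < h) by lra.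
  assert (HVc : 0 < V c).
  { apply (Rmult_lt_reg_l h); lra. }
  assert (Hxics : Derive V xi < Derive V cstar).
  { apply (Rmult_lt_reg_l (hstar * (c - cstar))).
    - apply Rmult_lt_0_compat; lra.
    - replace (hstar * (c - cstar) * Derive V xi) with (hstar * (V c - V cstar))
        by (rewrite Heq; ring).
      replace (hstar * (c - cstar) * Derive V cstar) with (c - cstar)
        by (transitivity ((hstar * Derive V cstar) * (c - cstar));
            [rewrite Hcrit; ring | ring]).
      assert (hstar * V c < h * V c) by (apply Rmult_lt_compat_r; lra).
      lra. }
  specialize (Hdec xi c ltac:(lra) (proj2 Hxi)).
  apply (Rmult_lt_reg_l c); [lra |].
  replace (c * (h * Derive V c)) with (h * (c * Derive V c)) by ring.
  replace (c * 1) with (h * V c) by lra.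
  apply Rmult_lt_compat_l; [lra |].
  assert (c * Derive V c < c * Derive V xi) by (apply Rmult_lt_compat_l; lra).
  assert (cstar * Derive V xi < cstar * Derive V cstar)
    by (apply Rmult_lt_compat_l; lra).
  lra.
Qed.

(** * Equations with memory: Picard iteration *)

(** Right-hand side of [p t = x0 + RInt (G p) 0 t] together with the prehistory
    [p t = x0] for [t <= 0]: freezing the upper limit at [0] covers both cases
    and keeps everything defined and continuous on the whole line. *)
Definition history_picard (G : (R -> R) -> R -> R) (x0 : R) (p : R -> R) (t : R) : R :=
  x0 + RInt (G p) 0 (Rmax 0 t).

Lemma continuous_Rmax_0 (t : R) : continuous (Rmax 0) t.
Proof.
  apply continuous_ext with (fun t => (t + Rabs t) * (1 / 2)).
  { intros x. unfold Rmax, Rabs. destruct (Rle_dec 0 x), (Rcase_abs x); lra. }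
  apply (continuous_mult (fun t => t + Rabs t) (fun _ => 1 / 2));
    [| apply continuous_const].
  apply (continuous_plus (fun t => t) Rabs);
    [apply continuous_id | apply continuous_Rabs].
Qed.

Lemma continuous_history_picard (G : (R -> R) -> R -> R) (x0 : R) (p : R -> R) :
  (forall s, continuous (G p) s) ->
  forall t, continuous (history_picard G x0 p) t.
Proof.
  intros HG t. unfold history_picard.
  apply (continuous_plus (fun _ => x0) (fun t => RInt (G p) 0 (Rmax 0 t)));
    [apply continuous_const |].
  apply (continuous_comp (Rmax 0) (fun u => RInt (G p) 0 u));
    [apply continuous_Rmax_0 |].
  now apply continuous_primitive.
Qed.

Lemma history_picard_past (G : (R -> R) -> R -> R) (x0 : R) (p : R -> R) (t : R) :
  t <= 0 -> history_picard G x0 p t = x0.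
Proof.
  intros Ht. unfold history_picard.
  rewrite Rmax_left by exact Ht. rewrite RInt_point. apply Rplus_0_r.
Qed.

(** The weight [exp (2 * Lam * t)] is increasing, so a bound by it at [t] also
    bounds the whole past of [t]; integrating it divides by [2 * Lam], which
    turns the Lipschitz constant [Lam] into the factor [1 / 2]. *)
Lemma history_picard_contraction (G : (R -> R) -> R -> R) (x0 Lam : R) (p q : R -> R) (A : R) :
  0 < Lam ->
  (forall s, continuous (G p) s) -> (forall s, continuous (G q) s) ->
  (forall t M, (forall s, s <= t -> Rabs (p s - q s) <= M) ->
     Rabs (G p t - G q t) <= Lam * M) ->
  (forall s, Rabs (p s - q s) <= A * exp (2 * Lam * s)) ->
  forall t, Rabs (history_picard G x0 p t - history_picard G x0 q t)
            <= A * (1 / 2) * exp (2 * Lam * t).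
Proof.
  intros HLam HGp HGq Hlip Hpq t.
  assert (HA : 0 <= A).
  { specialize (Hpq 0). rewrite Rmult_0_r, exp_0 in Hpq.
    pose proof (Rabs_pos (p 0 - q 0)). lra. }
  unfold history_picard.
  replace (x0 + RInt (G p) 0 (Rmax 0 t) - (x0 + RInt (G q) 0 (Rmax 0 t)))
    with (minus (RInt (G p) 0 (Rmax 0 t)) (RInt (G q) 0 (Rmax 0 t)))
    by (unfold minus, plus, opp; simpl; ring).
  rewrite <- RInt_minus by now apply continuous_ex_RInt.
  pose proof (exp_pos (2 * Lam * t)) as Hexp.
  destruct (Rle_lt_dec t 0) as [Ht | Ht].
  - rewrite Rmax_left by exact Ht. rewrite RInt_point. unfold zero. simpl.
    rewrite Rabs_R0. apply Rmult_le_pos; lra.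
  - rewrite Rmax_right by lra.
    assert (Hexp_int : is_RInt (fun s => Lam * (A * exp (2 * Lam * s))) 0 t
              (minus (A * (1 / 2) * exp (2 * Lam * t))
                     (A * (1 / 2) * exp (2 * Lam * 0)))).
    { apply (is_RInt_derive (fun s => A * (1 / 2) * exp (2 * Lam * s))).
      - intros s _. auto_derive; [trivial | field].
      - intros s _.
        apply (ex_derive_continuous (fun s => Lam * (A * exp (2 * Lam * s)))).
        auto_derive. trivial. }
    apply Rle_trans with (minus (A * (1 / 2) * exp (2 * Lam * t))
                     (A * (1 / 2) * exp (2 * Lam * 0))).
    + eapply (norm_RInt_le (fun s => minus (G p s) (G q s)));
        [apply Rlt_le, Ht | | | exact Hexp_int].
      * intros s Hs. apply Hlip. intros r Hr.
        eapply Rle_trans; [apply Hpq |].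
        apply Rmult_le_compat_l; [exact HA |].
        destruct (Rle_lt_or_eq_dec r s Hr) as [Hrs | ->]; [| lra].
        apply Rlt_le, exp_increasing, Rmult_lt_compat_l; lra.
      * apply (RInt_correct (fun s => minus (G p s) (G q s))), continuous_ex_RInt.
        intros s. now apply (continuous_minus (G p) (G q)).
    + unfold minus, plus, opp. simpl. rewrite Rmult_0_r, exp_0. lra.
Qed.

(** Global existence for an equation whose right-hand side depends on the past
    in a Lipschitz way.  The successive iterates differ by a geometric sequence
    times [exp (2 * Lam * t)]; the bound on [G] at the constant function [x0]
    starts this estimate.  The contraction estimate applies to the limit and the
    [n]-th iterate as well, and as [n] grows it identifies the limit as a fixed
    point. *)
Lemma history_picard_fixpoint (G : (R -> R) -> R -> R) (x0 Lam B : R) :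
  0 < Lam ->
  (forall p, (forall s, continuous p s) -> forall s, continuous (G p) s) ->
  (forall p q t M, (forall s, continuous p s) -> (forall s, continuous q s) ->
     (forall s, s <= t -> Rabs (p s - q s) <= M) ->
     Rabs (G p t - G q t) <= Lam * M) ->
  (forall t, 0 <= t -> Rabs (G (fun _ => x0) t) <= B) ->
  exists p, (forall s, continuous p s) /\ forall t, p t = history_picard G x0 p t.
Proof.
  intros HLam Hcont Hlip Hbound.
  set (T := history_picard G x0).
  set (u := fun n => Nat.iter n T (fun _ => x0)).
  set (A := B / (2 * Lam)).
  assert (Hu : forall n s, continuous (u n) s).
  { induction n as [| n IH].
    - intros s. apply continuous_const.
    - apply continuous_history_picard, Hcont, IH. }
  assert (HB : 0 <= B).
  { eapply Rle_trans; [apply Rabs_pos | apply (Hbound 0); lra]. }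
  assert (Hstep : forall n t,
            Rabs (u (S n) t - u n t) <= A * exp (2 * Lam * t) * (1 / 2) ^ n).
  { assert (Hstep' : forall n t,
            Rabs (u (S n) t - u n t) <= A * (1 / 2) ^ n * exp (2 * Lam * t)).
    { induction n as [| n IH]; intros t.
      (* The first step grows at most like [B * t], and
         [2 * Lam * t <= exp (2 * Lam * t)]. *)
      - change (u 1%nat t) with (x0 + RInt (G (fun _ => x0)) 0 (Rmax 0 t)).
        change (u 0%nat t) with x0.
        rewrite Rplus_minus_l.
        eapply Rle_trans.
        + apply abs_RInt_le_const; [apply Rmax_l | |].
          * apply continuous_ex_RInt, Hcont. intros s. apply continuous_const.
          * intros s Hs. apply Hbound, Hs.
        + unfold A. rewrite pow_O, Rminus_0_r, Rmult_1_r.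
          replace (B / (2 * Lam) * exp (2 * Lam * t))
            with (exp (2 * Lam * t) / (2 * Lam) * B) by (field; lra).
          apply Rmult_le_compat_r; [exact HB |].
          apply (Rmult_le_reg_l (2 * Lam)); [lra |].
          replace (2 * Lam * (exp (2 * Lam * t) / (2 * Lam)))
            with (exp (2 * Lam * t)) by (field; lra).
          pose proof (exp_pos (2 * Lam * t)).
          pose proof (exp_ineq1_le (2 * Lam * t)).
          unfold Rmax. destruct (Rle_dec 0 t); lra.
      - replace (A * (1 / 2) ^ S n) with (A * (1 / 2) ^ n * (1 / 2))
          by (simpl; ring).
        apply (history_picard_contraction G x0 Lam (u (S n)) (u n));
          auto. }
    intros n t. specialize (Hstep' n t). lra. }
  set (p := fun t => real (Lim_seq (fun n => u n t))).
  assert (Hlim : forall n t,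
            Rabs (p t - u n t) <= 2 * A * (1 / 2) ^ n * exp (2 * Lam * t)).
  { intros n t.
    pose proof (geometric_limit (fun n => u n t) _ (fun n => Hstep n t) n) as H.
    fold (p t) in H. lra. }
  assert (Hp : forall s, continuous p s).
  { intros s.
    apply (continuous_geometric_limit p u s (fun r => r < s + 1)
             (2 * A * exp (2 * Lam * (s + 1)))).
    - apply open_lt. lra.
    - intros n. apply Hu.
    - intros n r Hr. eapply Rle_trans; [apply Hlim |].
      replace (2 * A * exp (2 * Lam * (s + 1)) * (1 / 2) ^ n)
        with (2 * A * (1 / 2) ^ n * exp (2 * Lam * (s + 1))) by ring.
      apply Rmult_le_compat_l.
      + apply Rmult_le_pos; [| apply pow_le; lra].
        apply Rmult_le_pos; [lra |]. apply Rdiv_le_0_compat; lra.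
      + apply Rlt_le, exp_increasing, Rmult_lt_compat_l; lra. }
  exists p. split; [exact Hp |]. intros t. fold T.
  assert (Hz : Rabs (p t - T p t) <= 0).
  { apply (geometric_small _ (2 * A * exp (2 * Lam * t))). intros n.
    pose proof (history_picard_contraction G x0 Lam p (u n) _ HLam (Hcont p Hp)
                  (Hcont _ (Hu n)) (fun t M => Hlip p (u n) t M Hp (Hu n))
                  (Hlim n) t) as H1.
    change (history_picard G x0 (u n) t) with (u (S n) t) in H1.
    change (history_picard G x0 p t) with (T p t) in H1.
    pose proof (Hlim (S n) t) as H2. simpl pow in H2.
    rewrite Rabs_minus_sym in H1.
    replace (p t - T p t) with ((p t - u (S n) t) + (u (S n) t - T p t)) by ring.
    eapply Rle_trans; [apply Rabs_triang |]. lra. }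
  apply Rminus_diag_uniq.
  destruct (Req_dec (p t - T p t) 0) as [| Hne]; trivial.
  apply Rabs_pos_lt in Hne. lra.
Qed.

(** * The scalar equation for the speed perturbation *)

(** The right-hand side for the speed perturbation [p] of the wave of speed [c],
    once the headway perturbation is expressed as [- RInt p (t - 1) t]. *)
Definition speed_rate (V : R -> R) (h c : R) (p : R -> R) (t : R) : R :=
  h * p t - h ^ 2 * (V c - V (c - RInt p (t - 1) t)).

Lemma window_integral (p : R -> R) :
  (forall s, continuous p s) ->
  forall t, RInt p (t - 1) t = RInt p 0 t - RInt p 0 (t - 1).
Proof.
  intros Hp t.
  pose proof (RInt_Chasles p 0 (t - 1) t (continuous_ex_RInt p _ _ Hp)
                (continuous_ex_RInt p _ _ Hp)) as H.
  rewrite <- H. symmetry. apply Rplus_minus_l.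
Qed.

Lemma continuous_speed_rate (V : R -> R) (h c : R) (p : R -> R) :
  (forall s, continuous V s) -> (forall s, continuous p s) ->
  forall t, continuous (speed_rate V h c p) t.
Proof.
  intros HV Hp t.
  apply (continuous_minus (fun t => h * p t)
           (fun t => h ^ 2 * (V c - V (c - RInt p (t - 1) t)))).
  { apply (continuous_mult (fun _ => h) p); [apply continuous_const | apply Hp]. }
  apply (continuous_mult (fun _ => h ^ 2)
           (fun t => V c - V (c - RInt p (t - 1) t))); [apply continuous_const |].
  apply (continuous_minus (fun _ => V c) (fun t => V (c - RInt p (t - 1) t)));
    [apply continuous_const |].
  apply (continuous_comp (fun t => c - RInt p (t - 1) t) V); [| apply HV].
  apply (continuous_minus (fun _ => c) (fun t => RInt p (t - 1) t));
    [apply continuous_const |].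
  pose proof (continuous_primitive p 0 Hp) as HP.
  apply continuous_ext with (fun t => RInt p 0 t - RInt p 0 (t - 1)).
  { intros u. symmetry. now apply window_integral. }
  apply (continuous_minus (fun t => RInt p 0 t) (fun t => RInt p 0 (t - 1)));
    [apply HP |].
  apply (continuous_comp (fun t => t - 1) (fun u => RInt p 0 u)); [| apply HP].
  apply (continuous_minus (fun t => t) (fun _ => 1));
    [apply continuous_id | apply continuous_const].
Qed.

Lemma speed_rate_lipschitz (V : R -> R) (h c L : R) (p q : R -> R) (t M : R) :
  0 < h -> 0 < L ->
  (forall x y, Rabs (V x - V y) <= L * Rabs (x - y)) ->
  (forall s, continuous p s) -> (forall s, continuous q s) ->
  (forall s, s <= t -> Rabs (p s - q s) <= M) ->
  Rabs (speed_rate V h c p t - speed_rate V h c q t) <= (h + h ^ 2 * L) * M.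
Proof.
  intros Hh HL HV Hp Hq Hpq. unfold speed_rate.
  set (Ip := RInt p (t - 1) t). set (Iq := RInt q (t - 1) t).
  replace (h * p t - h ^ 2 * (V c - V (c - Ip)) - (h * q t - h ^ 2 * (V c - V (c - Iq))))
    with (h * (p t - q t) + h ^ 2 * (V (c - Ip) - V (c - Iq))) by ring.
  assert (HI : Rabs (Iq - Ip) <= M).
  { rewrite Rabs_minus_sym. unfold Ip, Iq.
    change (Rabs (minus (RInt p (t - 1) t) (RInt q (t - 1) t)) <= M).
    rewrite <- RInt_minus by now apply continuous_ex_RInt.
    replace M with ((t - (t - 1)) * M) by ring.
    apply abs_RInt_le_const; [lra | |].
    - apply continuous_ex_RInt. intros s. now apply (continuous_minus p q).
    - intros s Hs. apply Hpq. lra. }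
  assert (HVI : Rabs (V (c - Ip) - V (c - Iq)) <= L * M).
  { eapply Rle_trans; [apply HV |].
    replace (c - Ip - (c - Iq)) with (Iq - Ip) by ring.
    apply Rmult_le_compat_l; lra. }
  assert (Hh2 : 0 < h ^ 2) by (apply pow_lt, Hh).
  eapply Rle_trans; [apply Rabs_triang |].
  rewrite !Rabs_mult, (Rabs_pos_eq h), (Rabs_pos_eq (h ^ 2)) by lra.
  pose proof (Rmult_le_compat_l h _ _ ltac:(lra) (Hpq t (Rle_refl t))).
  pose proof (Rmult_le_compat_l (h ^ 2) _ _ ltac:(lra) HVI).
  lra.
Qed.

Lemma perturbation_exists (V : R -> R) (h c L x0 : R) :
  0 < h -> 0 < L ->
  (forall s, continuous V s) ->
  (forall x y, Rabs (V x - V y) <= L * Rabs (x - y)) ->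
  exists p, (forall s, continuous p s) /\
    forall t, p t = history_picard (speed_rate V h c) x0 p t.
Proof.
  intros Hh HL HVc HV.
  apply (history_picard_fixpoint (speed_rate V h c) x0 (h + h ^ 2 * L)
           (Rabs (speed_rate V h c (fun _ => x0) 0))).
  - pose proof (Rmult_lt_0_compat _ _ (pow_lt h 2 Hh) HL). lra.
  - intros p Hp. now apply continuous_speed_rate.
  - intros p q t M Hp Hq Hpq. now apply speed_rate_lipschitz.
  - intros t _. apply Req_le. f_equal. unfold speed_rate.
    rewrite !RInt_const. unfold scal. simpl. unfold mult. simpl.
    do 4 f_equal. ring.
Qed.

(** The growth mechanism: at an instant where [p] attains the maximum over its
    past, the delayed term cannot outweigh [h * p t], so such an instant is
    followed by larger values.  Applied to a maximum over [[0, t]] this leaves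
    only [t] itself, so that every instant is of this kind and [p] has slope at
    least [h * (1 - h * L) * x0]. *)
Lemma perturbation_unbounded (V : R -> R) (h c L rho x0 : R) (p : R -> R) :
  0 < h -> h * L < 1 -> 0 < x0 ->
  (forall s, continuous V s) ->
  (forall s t, s <= t -> V s <= V t) ->
  (forall x, 0 < x < rho -> V c - V (c - x) <= L * x) ->
  (forall s, continuous p s) ->
  (forall t, p t = history_picard (speed_rate V h c) x0 p t) ->
  exists t, 0 <= t /\ rho <= p t.
Proof.
  intros Hh HhL Hx0 HVc Hmon Hslope Hp Hfix.
  destruct (Classical_Prop.classic (exists t, 0 <= t /\ rho <= p t))
    as [| Hno]; trivial. exfalso.
  assert (Hsmall : forall t, 0 <= t -> p t < rho).
  { intros t Ht. apply Rnot_le_lt. intros Hle. apply Hno. now exists t. }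
  set (g := speed_rate V h c p).
  assert (Hg : forall s, continuous g s) by now apply continuous_speed_rate.
  (* [p] has a corner at [0]; [q] is a differentiable extension, to the left
     of [0], of what [p - x0] is to the right. *)
  set (q := fun t => RInt g 0 t).
  assert (Hq : forall t, is_derive q t (g t)) by now apply is_derive_primitive.
  assert (Hpq : forall t, 0 <= t -> p t = x0 + q t).
  { intros t Ht. rewrite Hfix. unfold history_picard. now rewrite Rmax_right. }
  assert (Hpast : forall t, t <= 0 -> p t = x0).
  { intros t Ht. rewrite Hfix. now apply history_picard_past. }
  assert (Hmvt : forall s t, 0 <= s -> s < t ->
            exists xi, s < xi < t /\ p t - p s = g xi * (t - s)).
  { intros s t Hs Hst.
    destruct (mean_value q s t) as [xi [Hxi Heq]]; trivial.
    { intros r. now exists (g r). }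
    exists xi. split; [exact Hxi |].
    rewrite (Hpq s), (Hpq t) by lra.
    rewrite <- (is_derive_unique q xi (g xi) (Hq xi)). lra. }
  assert (Hrecord : forall t, 0 <= t -> (forall s, s <= t -> p s <= p t) ->
            h * (1 - h * L) * x0 <= g t).
  { intros t Ht Hmax. unfold g, speed_rate.
    assert (Hpt : x0 <= p t).
    { rewrite <- (Hpast 0 (Rle_refl 0)). now apply Hmax. }
    assert (HI : RInt p (t - 1) t <= p t).
    { replace (p t) with (RInt (fun _ => p t) (t - 1) t).
      - apply RInt_le; [lra | now apply continuous_ex_RInt | |].
        + apply continuous_ex_RInt. intros s. apply continuous_const.
        + intros s Hs. apply Hmax. lra.
      - rewrite RInt_const. unfold scal. simpl. unfold mult. simpl. ring. }
    pose proof (Hmon (c - p t) (c - RInt p (t - 1) t) ltac:(lra)).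
    pose proof (Hslope (p t) (conj (Rlt_le_trans _ _ _ Hx0 Hpt) (Hsmall t Ht))).
    assert (h ^ 2 * (V c - V (c - RInt p (t - 1) t)) <= h ^ 2 * (L * p t)).
    { apply Rmult_le_compat_l; [apply pow_le |]; lra. }
    assert (h * (1 - h * L) * x0 <= h * (1 - h * L) * p t).
    { apply Rmult_le_compat_l; [apply Rmult_le_pos |]; lra. }
    lra. }
  assert (Hmu : 0 < h * (1 - h * L) * x0).
  { apply Rmult_lt_0_compat; [apply Rmult_lt_0_compat |]; lra. }
  assert (Hmono : forall t, 0 <= t -> forall s, s <= t -> p s <= p t).
  { intros t Ht.
    destruct (continuity_ab_maj p 0 t Ht) as [m [Hm Hm0t]].
    { intros s _. apply continuity_pt_filterlim, Hp. }
    assert (Hm' : forall s, s <= t -> p s <= p m).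
    { intros s Hs. destruct (Rle_lt_dec 0 s).
      - now apply Hm.
      - rewrite (Hpast s), <- (Hpast 0) by lra. apply Hm. lra. }
    destruct (Rle_lt_or_eq_dec m t (proj2 Hm0t)) as [Hmt | ->];
      [exfalso | exact Hm'].
    assert (Hgm : 0 < g m).
    { eapply Rlt_le_trans; [exact Hmu |]. apply Hrecord; [apply Hm0t |].
      intros s Hs. apply Hm'. lra. }
    destruct (proj1 (filterlim_locally _ _) (Hg m) (mkposreal _ Hgm)) as [e He].
    pose proof (cond_pos e).
    set (s := m + Rmin (e / 2) (t - m)).
    assert (Hs : m < s <= t /\ s < m + e).
    { unfold s, Rmin. destruct (Rle_dec (e / 2) (t - m)); lra. }
    destruct (Hmvt m s) as [xi [Hxi Heq]]; [lra | lra |].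
    assert (0 < g xi).
    { specialize (He xi). change (Rabs (xi - m) < e -> Rabs (g xi - g m) < g m) in He.
      rewrite Rabs_pos_eq in He by lra.
      specialize (He ltac:(lra)). apply Rabs_def2 in He. lra. }
    assert (0 < g xi * (s - m)) by (apply Rmult_lt_0_compat; lra).
    specialize (Hm' s). lra. }
  set (mu := h * (1 - h * L) * x0) in *.
  assert (Hrho : 0 < rho).
  { specialize (Hsmall 0 (Rle_refl 0)). rewrite Hpast in Hsmall; lra. }
  assert (HT : 0 < rho / mu) by now apply Rdiv_lt_0_compat.
  (* At slope [mu] or more, the height [rho] is reached by time [rho / mu]. *)
  destruct (Hmvt 0 (rho / mu)) as [xi [Hxi Heq]]; [lra | exact HT |].
  assert (Hgx : mu <= g xi).
  { apply Hrecord; [lra |]. apply Hmono. lra. }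
  assert (rho <= g xi * (rho / mu)).
  { replace rho with (mu * (rho / mu)) at 1 by (field; lra).
    apply Rmult_le_compat_r; lra. }
  rewrite (Hpast 0), Rminus_0_r in Heq by lra.
  specialize (Hsmall (rho / mu) ltac:(lra)). lra.
Qed.

(** * Functions with values in the plane and their norms *)

Lemma is_derive_pair (f g : R -> R) (t df dg : R) :
  is_derive f t df -> is_derive g t dg ->
  is_derive (fun s => (f s, g s) : R2) t ((df, dg) : R2).
Proof.
  intros Hf Hg.
  apply is_derive_ext with
    (fun s => plus (scal (f s) ((1, 0) : R2)) (scal (g s) ((0, 1) : R2))).
  { intros s. apply injective_projections;
      unfold plus, scal; simpl; unfold plus, mult, scal; simpl; unfold mult; simpl; ring. }
  replace ((df, dg) : R2)
    with (plus (scal df ((1, 0) : R2)) (scal dg ((0, 1) : R2)) : R2).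
  - apply (is_derive_plus (K := R_AbsRing) (V := R2)
             (fun s => scal (f s) ((1, 0) : R2))
             (fun s => scal (g s) ((0, 1) : R2))).
    + now apply (is_derive_scal_l (V := R2) f t df (1, 0)).
    + now apply (is_derive_scal_l (V := R2) g t dg (0, 1)).
  - apply injective_projections;
      unfold plus, scal; simpl; unfold plus, mult, scal; simpl; unfold mult; simpl; ring.
Qed.

Lemma continuous_pair (f g : R -> R) (t : R) :
  continuous f t -> continuous g t ->
  continuous (fun s => (f s, g s) : R2) t.
Proof.
  intros Hf Hg.
  apply (continuous_comp_2 (W := R_UniformSpace) (X := R2) f g pair t Hf Hg).
  apply continuous_ext with (fun x : R2 => x); [| apply continuous_id].
  intros x. apply surjective_pairing.
Qed.

Lemma norm_R2_le (x y M : R) :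
  Rabs x <= M -> Rabs y <= M -> norm ((x, y) : R2) <= 2 * M.
Proof.
  intros Hx Hy.
  assert (Hsqrt2 : sqrt 2 <= 2).
  { pose proof (sqrt_sqrt 2 ltac:(lra)). pose proof Rlt_sqrt2_0. nra. }
  pose proof (Rabs_pos x).
  eapply Rle_trans; [apply (norm_prod (U := R_NormedModule) (V := R_NormedModule) x y) |].
  apply Rle_trans with (sqrt 2 * M).
  - apply Rmult_le_compat_l; [apply sqrt_pos | now apply Rmax_lub].
  - apply Rmult_le_compat_r; lra.
Qed.

(** The value at [0] rules out [m_infty], which [real] would turn into [0]. *)
Lemma normC_le (phi : R -> R2) (M : R) :
  (forall s, -1 <= s <= 0 -> norm (phi s) <= M) -> normC phi <= M.
Proof.
  intros HM. unfold normC.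
  destruct (Lub_Rbar_correct (fun x => exists s, -1 <= s <= 0 /\ x = norm (phi s)))
    as [Hub Hlub].
  specialize (Hlub M ltac:(intros x [s [Hs ->]]; simpl; now apply HM)).
  specialize (Hub (norm (phi 0))
                ltac:(exists 0; split; [lra | reflexivity])).
  destruct (Lub_Rbar _); simpl in *; trivial; contradiction.
Qed.

(** The bound [M] guarantees that the supremum is finite; the infinite one would
    be read as [0]. *)
Lemma norm_le_normC (phi : R -> R2) (M : R) :
  (forall s, -1 <= s <= 0 -> norm (phi s) <= M) ->
  forall s, -1 <= s <= 0 -> norm (phi s) <= normC phi.
Proof.
  intros HM s Hs. unfold normC.
  destruct (Lub_Rbar_correct (fun x => exists s, -1 <= s <= 0 /\ x = norm (phi s)))
    as [Hub Hlub].
  specialize (Hlub M ltac:(intros x [r [Hr ->]]; simpl; now apply HM)).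
  specialize (Hub (norm (phi s)) ltac:(now exists s)).
  destruct (Lub_Rbar _); simpl in *; trivial; contradiction.
Qed.

(** * Back to the system *)

(** The restriction to [[-1, 0]] serves as initial segment: the position is a
    primitive of the speed there too, which is what the reduction to the
    scalar equation rests on. *)
Definition perturbed_wave (c d : R) (p : R -> R) : R -> R2 :=
  fun t => (- c * t + d + RInt p 0 t, - c + p t).

Lemma continuous_perturbed_wave (c d : R) (p : R -> R) :
  (forall s, continuous p s) -> forall t, continuous (perturbed_wave c d p) t.
Proof.
  intros Hp t.
  apply (continuous_pair (fun t => - c * t + d + RInt p 0 t) (fun t => - c + p t)).
  - apply (continuous_plus (fun t => - c * t + d) (fun t => RInt p 0 t)).
    + apply (ex_derive_continuous (fun t => - c * t + d)). auto_derive. trivial.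
    + now apply continuous_primitive.
  - apply (continuous_plus (fun _ => - c) p); [apply continuous_const | apply Hp].
Qed.

Lemma perturbed_wave_solution (V : R -> R) (h c d x0 : R) (p : R -> R) :
  (forall s, continuous V s) -> h * V c = c ->
  (forall s, continuous p s) ->
  (forall t, p t = history_picard (speed_rate V h c) x0 p t) ->
  is_solution V h (perturbed_wave c d p) (perturbed_wave c d p).
Proof.
  intros HV Hc Hp Hfix.
  set (w := perturbed_wave c d p).
  set (g := speed_rate V h c p).
  assert (Hg : forall s, continuous g s) by now apply continuous_speed_rate.
  split; [| split].
  - intros s _. unfold segment. now rewrite Rplus_0_l.
  - apply continuous_on_forall. intros t _. now apply continuous_perturbed_wave.
  - assert (Hrhs : forall t, rhs V h (segment w t) = (- c + p t, g t)).
    { intros t. unfold rhs, segment, w, perturbed_wave. simpl fst. simpl snd.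
      rewrite Rplus_0_r. f_equal. unfold g, speed_rate.
      rewrite window_integral by exact Hp.
      change (t + -1) with (t - 1).
      replace (- c * (t - 1) + d + RInt p 0 (t - 1) - (- c * t + d + RInt p 0 t))
        with (c - (RInt p 0 t - RInt p 0 (t - 1))) by ring.
      rewrite <- Hc at 2. ring. }
    exists (fun t => (- c + p t, g t) : R2). intros t Ht. split; [| split].
    + apply is_derive_pair.
      * apply (is_derive_plus (fun t => - c * t + d) (fun t => RInt p 0 t)).
        -- auto_derive; [trivial | ring].
        -- now apply is_derive_primitive.
      * apply is_derive_ext_loc with (fun t => (- c + x0) + RInt g 0 t).
        -- exists (mkposreal t Ht). intros s Hs.
           change (Rabs (s - t) < t) in Hs. apply Rabs_def2 in Hs.
           rewrite (Hfix s). unfold history_picard. rewrite Rmax_right by lra.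
           apply Rplus_assoc.
        -- replace (g t) with (plus zero (g t)) by apply plus_zero_l.
           apply (is_derive_plus (fun _ => - c + x0) (fun t => RInt g 0 t)).
           ++ apply (is_derive_const (V := R_NormedModule)).
           ++ now apply is_derive_primitive.
    + apply (continuous_pair (fun t => - c + p t) g); [| apply Hg].
      apply (continuous_plus (fun _ => - c) p); [apply continuous_const | apply Hp].
    + symmetry. apply Hrhs.
Qed.

Lemma wave_deviation (c d : R) (p : R -> R) (t s : R) :
  minus (segment (wavefront c d) t s) (segment (perturbed_wave c d p) t s)
  = ((- RInt p 0 (t + s), - p (t + s)) : R2).
Proof.
  apply injective_projections; unfold segment, wavefront, perturbed_wave,
    minus, plus, opp; simpl; unfold plus, opp; simpl; ring.
Qed.

Theorem theorem5p2 (V : R -> R) (cstar hstar h c d : R)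
  (hV : optimal_velocity V)
  (hstar_crit : critical_pair V cstar hstar)
  (h_gt : hstar < h)
  (c_branch : second_branch V cstar h c) :
  unstable V h c d.
Proof.
  pose proof (second_branch_slope _ _ _ _ _ hV hstar_crit h_gt c_branch) as Hslope.
  assert (Hh : 0 < h) by (destruct hstar_crit as (_ & ? & _); lra).
  destruct c_branch as [_ Hc].
  pose proof (ovf_ex_derive V hV) as Hder.
  assert (HVc : forall s, continuous V s).
  { intros s. apply (ex_derive_continuous V), Hder. }
  destruct (ovf_lipschitz V hV) as [LV [HLV HLip]].
  (* Any number strictly between [Derive V c] and [/ h] would do. *)
  set (L := (Derive V c + / h) / 2).
  assert (HL : Derive V c < L /\ h * L < 1).
  { assert (Hlt : Derive V c < / h).
    { apply (Rmult_lt_reg_l h); [exact Hh |]. rewrite Rinv_r by lra. exact Hslope. }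
    assert (HhL : L < / h) by (unfold L; lra).
    apply (Rmult_lt_compat_l h) in HhL; [| exact Hh].
    rewrite Rinv_r in HhL by lra. split; [unfold L |]; lra. }
  destruct (derivative_secant_bound V c L (Hder c) (proj1 HL)) as [rho [Hrho Hsec]].
  intros Hstable.
  destruct (Hstable rho Hrho) as [delta [Hdelta Hstab]].
  (* Both components of the deviation are at most [x0] on [[-1, 0]], so its norm
     is at most [2 * x0 < delta]. *)
  set (x0 := delta / 4).
  assert (Hx0 : 0 < x0) by (unfold x0; lra).
  destruct (perturbation_exists V h c LV x0 Hh HLV HVc HLip) as [p [Hp Hfix]].
  destruct (perturbation_unbounded V h c L rho x0 p Hh (proj2 HL) Hx0 HVc
              (ovf_monotone V hV) Hsec Hp Hfix) as [t [Ht Hpt]].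
  assert (Hpast : forall s, s <= 0 -> p s = x0).
  { intros s Hs. rewrite Hfix. now apply history_picard_past. }
  set (w := perturbed_wave c d p).
  assert (Hclose : distC (segment (wavefront c d) 0) w < delta).
  { apply Rle_lt_trans with (2 * x0); [| unfold x0; lra].
    apply normC_le. intros s Hs.
    replace (w s) with (segment w 0 s) by (unfold segment; now rewrite Rplus_0_l).
    unfold w. rewrite wave_deviation, Rplus_0_l, (Hpast s) by lra.
    assert (Hz : RInt p 0 s = s * x0).
    { rewrite (RInt_ext p (fun _ => x0)).
      - rewrite RInt_const. unfold scal. simpl. unfold mult. simpl. ring.
      - intros r Hr. apply Hpast. rewrite Rmax_left in Hr; lra. }
    rewrite Hz.
    apply norm_R2_le.
    - rewrite Rabs_Ropp, Rabs_mult, (Rabs_pos_eq x0) by lra.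
      rewrite <- (Rmult_1_l x0) at 2. apply Rmult_le_compat_r; [lra |].
      apply Rabs_le. lra.
    - rewrite Rabs_Ropp, Rabs_pos_eq; lra. }
  assert (HinC : inC w).
  { apply continuous_on_forall. intros s _. now apply continuous_perturbed_wave. }
  specialize (Hstab w w HinC (perturbed_wave_solution V h c d x0 p HVc Hc Hp Hfix)
                Hclose t Ht).
  revert Hstab. apply Rle_not_lt.
  eapply Rle_trans; [exact Hpt |].
  (* Boundedness of the deviation on [[t - 1, t]] is what makes the norm of the
     segment an honest supremum. *)
  set (z := fun r => RInt p 0 r).
  pose proof (continuous_primitive p 0 Hp : forall r, continuous z r) as Hz.
  destruct (ex_RInt_ub z (t - 1) t (continuous_ex_RInt z _ _ Hz)) as [Mz HMz].
  destruct (ex_RInt_ub p (t - 1) t (continuous_ex_RInt p _ _ Hp)) as [Mp HMp].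
  rewrite Rmin_left, Rmax_right in HMz, HMp by lra.
  apply Rle_trans with
    (norm (minus (segment (wavefront c d) t 0) (segment w t 0))).
  - unfold w. rewrite wave_deviation, Rplus_0_r.
    eapply Rle_trans; [| apply (norm_prod (- RInt p 0 t) (- p t))].
    eapply Rle_trans; [| apply Rmax_r].
    change (p t <= Rabs (- p t)). rewrite Rabs_Ropp. apply Rle_abs.
  - apply (norm_le_normC (fun s => minus (segment (wavefront c d) t s) (segment w t s))
             (2 * Rmax Mz Mp)); [| lra].
    intros s Hs. unfold w. rewrite wave_deviation.
    apply norm_R2_le; rewrite Rabs_Ropp.
    + eapply Rle_trans; [apply (HMz (t + s)); lra | apply Rmax_l].
    + eapply Rle_trans; [apply (HMp (t + s)); lra | apply Rmax_r].
Qed.
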